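(* Let $u$ be a nonempty word, let $m$ be the maximum letter of $u$, and let $\ell$ be the number of rows of $P(u)$. If $w$ is a word with $uw\equiv wu$, then every entry in the first $\ell$ rows of $P(w)$ is at most $m$.
   Context: A word is a finite string of positive integers. $P(w)$ denotes the RSK (row) insertion tableau of $w$, a semistandard Young tableau; rows are numbered from top to bottom. Knuth equivalence $\equiv$ is the equivalence relation on words generated by $xacby\equiv xcaby$ for $a\le b<c$ and $xbacy\equiv xbcay$ for $a<b\le c$ (with $x,y$ words and $a,b,c$ letters); $v\equiv w$ iff $P(v)=P(w)$. The plactic centralizer of $u$ is $C(u)=\{w: uw\equiv wu\}$. *)

(* Defs.v *)
From mathcomp Require Import all_boot.
From Stdlib Require Import Relations.

Set Implicit Arguments.
Unset Strict Implicit.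
Unset Printing Implicit Defensive.

(* Words are sequences of natural numbers; positivity of the letters is a
   separate predicate.  The Knuth relations permute letters, so the congruence
   on [seq nat] restricts to the one on words with positive letters. *)
Definition word (w : seq nat) : bool := all (fun a => 0 < a) w.

Definition max_letter (w : seq nat) : nat := \max_(a <- w) a.

Inductive knuth_step : seq nat -> seq nat -> Prop :=
| knuth_acb (x y : seq nat) (a b c : nat) : a <= b -> b < c ->
    knuth_step (x ++ [:: a; c; b] ++ y) (x ++ [:: c; a; b] ++ y)
| knuth_bac (x y : seq nat) (a b c : nat) : a < b -> b <= c ->
    knuth_step (x ++ [:: b; a; c] ++ y) (x ++ [:: b; c; a] ++ y).

Definition knuth_equiv : seq nat -> seq nat -> Prop :=
  clos_refl_sym_trans (seq nat) knuth_step.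

(* [x] replaces the leftmost entry greater than [x], which is returned as the
   bumped letter; if there is none, [x] is appended at the end of the row. *)
Fixpoint row_insert (x : nat) (r : seq nat) : option nat * seq nat :=
  if r is y :: r' then
    if x < y then (Some y, x :: r')
    else let: (bumped, s) := row_insert x r' in (bumped, y :: s)
  else (None, [:: x]).

(* A tableau is the list of its rows, from top to bottom. *)
Fixpoint tab_insert (x : nat) (t : seq (seq nat)) : seq (seq nat) :=
  if t is r :: t' then
    match row_insert x r with
    | (Some y, s) => s :: tab_insert y t'
    | (None, s) => s :: t'
    end
  else [:: [:: x]].

Definition insertion_tableau (w : seq nat) : seq (seq nat) :=
  foldl (fun t x => tab_insert x t) [::] w.

(* Main.v *)
Require Import Defs.
From mathcomp Require Import all_boot.
From mathcomp Require Import zify.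
From Stdlib Require Import Relations.

Set Implicit Arguments.
Unset Strict Implicit.
Unset Printing Implicit Defensive.

(* Let v be the reading word of P(u): it is Knuth equivalent to u, hence
   v^n w and w v^n are equivalent for all n, and it contains a strictly
   decreasing subsequence of length l.  Call a letter large if it exceeds m.

   Inserting v^n into P(w) sends some letter into each of the first l rows n
   times or more.  A small letter entering a row with large entries lowers the
   sum of that row, so for n large enough no large letter is left in the first l
   rows of P(w v^n).

   On the other hand, multiplying w on the left by a letter amounts to column
   insertion, which moves letters weakly upwards.  Hence the first l rows of
   P(v^n w) contain at least as many large letters as those of P(w).  As
   P(v^n w) = P(w v^n), there are none in P(w). *)

(** * Insertion of a word, one row at a time *)

Definition bumped (x : nat) (r : seq nat) : seq nat :=
  if (row_insert x r).1 is Some y then [:: y] else [::].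

Definition bumping_row (x : nat) (r : seq nat) : seq nat := (row_insert x r).2.

Fixpoint bumped_word (r v : seq nat) : seq nat :=
  if v is x :: v' then bumped x r ++ bumped_word (bumping_row x r) v'
  else [::].

Definition insert_word_row (r v : seq nat) : seq nat :=
  foldl (fun r x => bumping_row x r) r v.

Definition insert_word (t : seq (seq nat)) (v : seq nat) : seq (seq nat) :=
  foldl (fun t x => tab_insert x t) t v.

Definition reading_word (t : seq (seq nat)) : seq nat := flatten (rev t).

(* [dominates ltn r s] says that [s] can be the row below [r] in a tableau. *)
Fixpoint dominates (e : rel nat) (r s : seq nat) : bool :=
  match r, s with
  | _, [::] => true
  | [::], _ :: _ => false
  | a :: r', b :: s' => e a b && dominates e r' s'
  end.

Fixpoint tableau (t : seq (seq nat)) : bool :=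
  if t is r :: t' then
    [&& r != [::], sorted leq r, dominates ltn r (head [::] t') & tableau t']
  else true.

Lemma bumped_cons x y r :
  bumped x (y :: r) = if x < y then [:: y] else bumped x r.
Proof. by rewrite /bumped /=; case: ltnP => // _; case: row_insert. Qed.

Lemma bumping_row_cons x y r :
  bumping_row x (y :: r) = if x < y then x :: r else y :: bumping_row x r.
Proof. by rewrite /bumping_row /=; case: ltnP => // _; case: row_insert. Qed.

Lemma bumped_word_cat r v1 v2 :
  bumped_word r (v1 ++ v2) =
    bumped_word r v1 ++ bumped_word (insert_word_row r v1) v2.
Proof. by elim: v1 r => //= x v1 IH r; rewrite IH catA. Qed.

Lemma insert_word_row_cat r v1 v2 :
  insert_word_row r (v1 ++ v2) = insert_word_row (insert_word_row r v1) v2.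
Proof. exact: foldl_cat. Qed.

Lemma insert_word_cat t v1 v2 :
  insert_word t (v1 ++ v2) = insert_word (insert_word t v1) v2.
Proof. exact: foldl_cat. Qed.

Lemma tab_insert_cons x r t :
  tab_insert x (r :: t) = bumping_row x r :: insert_word t (bumped x r).
Proof. by rewrite /bumped /bumping_row /=; case: row_insert => -[y|] s. Qed.

(** The rows below [r] see only the letters bumped out of [r], in the order of bumping. So [r] may
    process all of [v] before anything is passed down, which allows inductions on the rows instead
    of on the letters. *)
Lemma insert_word_cons r t v :
  insert_word (r :: t) v = insert_word_row r v :: insert_word t (bumped_word r v).
Proof.
elim: v r t => // x v IH r t.
have -> : insert_word (r :: t) (x :: v) = insert_word (tab_insert x (r :: t)) v.
  by [].
by rewrite tab_insert_cons IH -insert_word_cat.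
Qed.

(** This treats an empty tableau as one with an empty first row. If [v] is empty as well, no row is
    created, whence the side condition. *)
Lemma insert_word_behead t v : (t != [::]) || (v != [::]) ->
  insert_word t v =
    insert_word_row (head [::] t) v
      :: insert_word (behead t) (bumped_word (head [::] t) v).
Proof.
case: t => [|r t] /=; last by rewrite insert_word_cons.
by case: v => //= x v _; rewrite -insert_word_cons.
Qed.

Lemma perm_bumping_row x r :
  perm_eq (bumped x r ++ bumping_row x r) (rcons r x).
Proof.
elim: r => [|y r IH]; first by rewrite /bumped /bumping_row.
rewrite bumped_cons bumping_row_cons; case: ifP => _ /=.
  by rewrite perm_cons -cat1s -cats1 perm_catC.
rewrite -cat1s perm_catCA /= perm_cons //.
Qed.

Lemma perm_insert_word_row r v :
  perm_eq (bumped_word r v ++ insert_word_row r v) (r ++ v).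
Proof.
elim: v r => [|x v IH] r /=; first by rewrite cats0.
rewrite -catA (perm_trans (perm_cat (perm_refl _) (IH _))) //.
by rewrite catA -cat_rcons perm_cat2r perm_bumping_row.
Qed.

Lemma mem_bumping_row x r : x \in bumping_row x r.
Proof.
elim: r => [|y r IH]; first by rewrite /bumping_row /= inE.
by rewrite bumping_row_cons; case: ifP; rewrite inE ?eqxx ?IH ?orbT.
Qed.

Lemma all_bumping_row (a : pred nat) x r :
  all a (bumped x r) && all a (bumping_row x r) = all a r && a x.
Proof. by rewrite -all_cat (perm_all _ (perm_bumping_row _ _)) all_rcons andbC. Qed.

Lemma bumped_lt x y r : x < y -> bumped x (y :: r) = [:: y].
Proof. by rewrite bumped_cons => ->. Qed.

Lemma bumped_ge x y r : y <= x -> bumped x (y :: r) = bumped x r.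
Proof. by rewrite bumped_cons ltnNge => ->. Qed.

Lemma bumping_row_lt x y r : x < y -> bumping_row x (y :: r) = x :: r.
Proof. by rewrite bumping_row_cons => ->. Qed.

Lemma bumping_row_ge x y r :
  y <= x -> bumping_row x (y :: r) = y :: bumping_row x r.
Proof. by rewrite bumping_row_cons ltnNge => ->. Qed.

Lemma path_bumping_row z x r : z <= x -> path leq z r ->
  path leq z (bumping_row x r).
Proof.
elim: r z => [|y r IH] z zx; first by rewrite /bumping_row /= zx.
rewrite bumping_row_cons /= => /andP[zy yr]; case: ltnP => xy /=.
  rewrite zx; case: r yr {IH} => //= a r /andP[ya ->].
  by rewrite andbT (leq_trans (ltnW xy)).
by rewrite zy IH.
Qed.

Lemma sorted_bumping_row x r : sorted leq r -> sorted leq (bumping_row x r).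
Proof.
case: r => [|y r] //=; rewrite bumping_row_cons; case: ltnP => xy yr /=.
  by case: r yr => //= a r /andP[ya ->]; rewrite (leq_trans (ltnW xy)).
exact: path_bumping_row.
Qed.

Lemma sorted_insert_word_row r v :
  sorted leq r -> sorted leq (insert_word_row r v).
Proof. by elim: v r => //= x v IH r /(sorted_bumping_row x); apply: IH. Qed.

Lemma size_bumped_word r v : size (bumped_word r v) <= size v.
Proof.
elim: v r => //= x v IH r; rewrite size_cat -add1n leq_add //.
by rewrite /bumped; case: (row_insert _ _).1.
Qed.

Variant bumped_spec x (r : seq nat) : seq nat -> Prop :=
| BumpedNone of all (leq^~ x) r : bumped_spec x r [::]
| BumpedSome z of x < z & z \in r : bumped_spec x r [:: z].

Lemma bumpedP x r : bumped_spec x r (bumped x r).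
Proof.
elim: r => [|y r IH]; first by constructor.
rewrite bumped_cons; case: ltnP => xy; first by constructor; rewrite ?inE ?eqxx.
case: IH => [h|z xz zr]; constructor; rewrite //= ?xy //.
by rewrite inE zr orbT.
Qed.

Lemma bumped_leq x r z : sorted leq r -> z \in r -> x < z ->
  exists2 y, bumped x r = [:: y] & y <= z.
Proof.
elim: r => // y r IH sr; rewrite bumped_cons; case: (ltnP x y) => xy zr xz.
  exists y => //; move: zr; rewrite inE => /predU1P [->//|].
  by move/(order_path_min leq_trans)/allP: sr => h /h.
apply: IH => //; first exact: path_sorted sr.
by move: zr; rewrite inE => /predU1P [zy|//]; move: xz; rewrite zy ltnNge xy.
Qed.

(** * Knuth equivalent words have the same insertion tableau *)

Variant knuth_triple : seq nat -> seq nat -> Prop :=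
| KnuthACB a b c of a <= b & b < c : knuth_triple [:: a; c; b] [:: c; a; b]
| KnuthBAC a b c of a < b & b <= c : knuth_triple [:: b; a; c] [:: b; c; a].

(** Entries at most all three letters are passed over, so the work starts at the first entry [y]
    above the smallest letter [a]. The conclusion allows both directions because an ACB triple below
    [y] may bump out a BAC triple with the two sides exchanged. *)
Lemma knuth_triple_row r v v' : sorted leq r -> knuth_triple v v' ->
  insert_word_row r v = insert_word_row r v' /\
  [\/ bumped_word r v = bumped_word r v',
      knuth_triple (bumped_word r v) (bumped_word r v') |
      knuth_triple (bumped_word r v') (bumped_word r v)].
Proof.
elim: r => [|y r IH] sr K.
  have b0 x : bumped x [::] = [::] by [].
  have r0 x : bumping_row x [::] = [:: x] by [].
  case: K => a b c ab bc.
    have ac := leq_ltn_trans ab bc.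
    rewrite /= !(b0, r0) (bumped_lt _ ac) (bumping_row_lt _ ac).
    rewrite (bumped_ge _ (ltnW ac)) (bumping_row_ge _ (ltnW ac)) !(b0, r0).
    rewrite !(bumped_ge _ ab) !(bumping_row_ge _ ab) !(b0, r0).
    by rewrite (bumped_lt _ bc) (bumping_row_lt _ bc); split; [|apply: Or31].
  have ac := leq_trans ab bc.
  rewrite /= !(b0, r0) (bumped_lt _ ab) (bumping_row_lt _ ab).
  rewrite (bumped_ge _ (ltnW ac)) (bumping_row_ge _ (ltnW ac)).
  rewrite (bumped_ge _ bc) (bumping_row_ge _ bc) !(b0, r0).
  by rewrite (bumped_lt _ ab) (bumping_row_lt _ ab); split; [|apply: Or31].
have {}IH := IH (path_sorted sr) K.
have pass a b c : y <= a -> y <= b -> y <= c ->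
  (bumped_word (y :: r) [:: a; b; c] = bumped_word r [:: a; b; c]) *
  (insert_word_row (y :: r) [:: a; b; c] = y :: insert_word_row r [:: a; b; c]).
  move=> ya yb yc.
  by split=> /=; rewrite ?(bumping_row_ge _ ya, bumped_ge _ ya)
    ?(bumping_row_ge _ yb, bumped_ge _ yb) ?(bumping_row_ge _ yc, bumped_ge _ yc).
have geE x : all (leq y) r -> y <= x -> all (leq y) (bumping_row x r).
  by move=> h yx; have := all_bumping_row (leq y) x r; rewrite h yx => /andP[].
have yr : all (leq y) r := order_path_min leq_trans sr.
case: K IH => a b c ab bc IH.
  have ac := leq_ltn_trans ab bc.
  case: (ltnP a y) => [ay|ya]; last first.
    have yb := leq_trans ya ab; have yc := leq_trans ya (ltnW ac).
    by move: IH; rewrite !pass // => -[-> H]; split.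
  clear IH; case: (ltnP c y) => [cy|yc]; rewrite /=.
    have by_ := ltn_trans bc cy.
    rewrite (bumping_row_lt _ ay) (bumped_lt _ ay).
    rewrite (bumping_row_lt _ cy) (bumped_lt _ cy).
    rewrite (bumping_row_lt _ ac) (bumped_lt _ ac).
    rewrite !(bumping_row_ge _ (ltnW ac), bumped_ge _ (ltnW ac)).
    rewrite !(bumping_row_ge _ ab, bumped_ge _ ab).
    case: r yr {sr pass geE} => [|z r] /=; last case/andP => yz _.
      by rewrite /bumped /= /bumping_row /= bc /=; split; [|apply: Or31].
    have cz := leq_trans cy yz; have bz := ltn_trans bc cz.
    rewrite (bumping_row_lt _ cz) (bumped_lt _ cz) (bumping_row_lt _ bz).
    rewrite (bumping_row_lt _ bc) (bumped_lt _ bc) (bumped_lt _ bz).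
    by split=> //; apply: Or33; apply: KnuthBAC.
  rewrite (bumping_row_lt _ ay) (bumped_lt _ ay).
  rewrite (bumping_row_ge _ yc) (bumped_ge _ yc).
  rewrite (bumping_row_lt _ ay) (bumped_lt _ ay).
  rewrite !(bumping_row_ge _ (ltnW ac), bumped_ge _ (ltnW ac)).
  rewrite !(bumping_row_ge _ ab, bumped_ge _ ab).
  split=> //.
  (* Once inserted, [c] is an entry greater than [b], so [b] bumps some [t] with [y <= t <= c]. The
     bumped letters [y], [t] and a possible [z > c] then form an ACB triple. *)
  have [t Et tc] := bumped_leq (sorted_bumping_row c (path_sorted sr))
     (mem_bumping_row c r) bc.
  have yt : y <= t.
    by move: (Et) (geE _ yr yc); case: bumpedP => // t0 _ tr [<-] /allP/(_ _ tr).
  rewrite Et; case: bumpedP => [_|z cz _] /=; first by apply: Or31.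
  by apply: Or32; apply: KnuthACB => //; apply: leq_ltn_trans cz.
have ac := leq_trans ab bc.
case: (ltnP a y) => [ay|ya]; last first.
  have yb := leq_trans ya (ltnW ab); have yc := leq_trans yb bc.
  by move: IH; rewrite !pass // => -[-> H]; split.
clear IH; case: (ltnP b y) => [by_|yb]; rewrite /=.
  rewrite (bumping_row_lt _ by_) (bumped_lt _ by_).
  rewrite (bumping_row_lt _ ab) (bumped_lt _ ab).
  rewrite (bumping_row_ge _ (ltnW ac)) (bumped_ge _ (ltnW ac)).
  rewrite (bumping_row_ge _ bc) (bumped_ge _ bc).
  rewrite (bumping_row_lt _ ab) (bumped_lt _ ab).
  split=> //; case: bumpedP => [_|z cz zr] /=; first by apply: Or31.
  apply: Or32; apply: KnuthBAC => //.
  by apply: (allP yr).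
have yc := leq_trans yb bc.
rewrite (bumping_row_ge _ yb) (bumped_ge _ yb).
rewrite (bumping_row_lt _ ay) (bumped_lt _ ay).
rewrite (bumping_row_ge _ yc) (bumped_ge _ yc).
rewrite (bumping_row_lt _ ay) (bumped_lt _ ay).
rewrite (bumping_row_ge _ (ltnW ac)) (bumped_ge _ (ltnW ac)).
split=> //; set r' := bumping_row b r.
(* An entry of [r'] above [b] was already in [r]. Hence the [z] bumped by [c] was available to [b],
   which therefore bumped some [t <= z]. *)
have br' : {in r', forall z, b < z -> z \in r}.
  move=> z zr bz; have := perm_mem (perm_bumping_row b r) z.
  rewrite mem_cat -/r' zr orbT mem_rcons inE => /esym/predU1P[zb|//].
  by move: bz; rewrite zb ltnn.
case: (bumpedP c r') => [_|z cz zr']; first by apply: Or31.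
have bz := leq_ltn_trans bc cz.
have [t Et tz] := bumped_leq (path_sorted sr) (br' _ zr' bz) bz.
rewrite Et /=; apply: Or32; apply: KnuthBAC => //.
by move: (Et); case: bumpedP => // t0 bt _ [<-]; apply: leq_ltn_trans bt.
Qed.

Lemma knuth_step_triple v v' :
  knuth_step v v' -> exists x y p p', [/\ knuth_triple p p',
    v = x ++ p ++ y & v' = x ++ p' ++ y].
Proof.
case=> x y a b c ab bc; exists x, y.
  by exists [:: a; c; b], [:: c; a; b]; split=> //; constructor.
by exists [:: b; a; c], [:: b; c; a]; split=> //; constructor.
Qed.

Lemma knuth_triple_step x y p p' :
  knuth_triple p p' -> knuth_step (x ++ p ++ y) (x ++ p' ++ y).
Proof.
by case=> a b c ab bc; constructor.
Qed.

Lemma knuth_step_row r v v' : sorted leq r -> knuth_step v v' ->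
  insert_word_row r v = insert_word_row r v' /\
  [\/ bumped_word r v = bumped_word r v',
      knuth_step (bumped_word r v) (bumped_word r v') |
      knuth_step (bumped_word r v') (bumped_word r v)].
Proof.
move=> sr /knuth_step_triple [x [y [p [p' [K -> ->]]]]].
have [E H] := knuth_triple_row (sorted_insert_word_row x sr) K.
rewrite !insert_word_row_cat E; split=> //; rewrite !bumped_word_cat E.
case: H => [->|K'|K']; first by apply: Or31.
  by apply: Or32; apply: knuth_triple_step.
by apply: Or33; apply: knuth_triple_step.
Qed.

Lemma insert_word_knuth_step t v v' : all (sorted leq) t -> knuth_step v v' ->
  insert_word t v = insert_word t v'.
Proof.
(* The measure drops at each row: a nonempty tableau loses its first row, while for an empty one the
   first letter of [v] settles in the new row without bumping, so the bumped word is shorter than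
   [v]. *)
elim: {t v}(size t + size v).+1 {-2}t {-2}v v' (ltnSn (size t + size v))
  => // n IH t v v' sz st K.
have [nv nv'] : v != [::] /\ v' != [::] by case: (K) => -[].
have sv : size v = size v' by case: (K) => *; rewrite !size_cat.
have bh u : u != [::] -> insert_word t u = insert_word_row (head [::] t) u
    :: insert_word (behead t) (bumped_word (head [::] t) u).
  by move=> nu; rewrite [LHS]insert_word_behead ?nu ?orbT.
rewrite !bh // {bh}.
have sh : sorted leq (head [::] t) by case: t st {sz} => //= r t /andP[].
have sb : all (sorted leq) (behead t) by case: t st {sz sh} => //= r t /andP[].
have [-> H] := knuth_step_row sh K; congr (_ :: _).
have lt_size u : u != [::] -> size u = size v ->
    size (behead t) + size (bumped_word (head [::] t) u) < n.
  case: t sz {st sh sb H} => [|r t] sz nu su /=.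
    case: u nu su => // x u _ /= su; move: (size_bumped_word [:: x] u) sz.
    by rewrite -su /bumping_row /bumped /=; lia.
  by move: (size_bumped_word r u) sz; rewrite su /=; lia.
case: H => [->//|K'|K'].
  by apply: IH => //; apply: lt_size.
by apply/esym; apply: IH => //; apply: lt_size.
Qed.

Lemma insertion_tableau_knuth v v' :
  knuth_equiv v v' -> insertion_tableau v = insertion_tableau v'.
Proof.
elim=> {v v'} [v v' K|//|v v' _ ->//|v1 v2 v3 _ -> _ ->//].
exact: (@insert_word_knuth_step [::]).
Qed.

(** * Knuth equivalence is a congruence and preserves content *)

Lemma knuth_equiv_ctx x y v v' :
  knuth_equiv v v' -> knuth_equiv (x ++ v ++ y) (x ++ v' ++ y).
Proof.
elim=> {v v'} [v v' /knuth_step_triple|v|v v' _ IH|v1 v2 v3 _ IH1 _ IH2].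
- move=> [x' [y' [p [p' [K -> ->]]]]].
  have := knuth_triple_step (x ++ x') (y' ++ y) K.
  by rewrite -!catA => ?; apply: rst_step.
- exact: rst_refl.
- exact: rst_sym.
- exact: rst_trans IH1 IH2.
Qed.

Lemma knuth_equiv_catl x v v' : knuth_equiv v v' -> knuth_equiv (x ++ v) (x ++ v').
Proof. by move/(knuth_equiv_ctx x [::]); rewrite !cats0. Qed.

Lemma knuth_equiv_catr y v v' : knuth_equiv v v' -> knuth_equiv (v ++ y) (v' ++ y).
Proof. exact: (@knuth_equiv_ctx [::]). Qed.

Lemma knuth_equiv_perm v v' : knuth_equiv v v' -> perm_eq v v'.
Proof.
elim=> {v v'} [v v' []|v|v v' _|v1 v2 v3 _ p12 _ p23].
- move=> x y a b c _ _; rewrite perm_cat2l perm_cat2r.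
  by rewrite -(cat1s a) -(cat1s c) perm_catCA.
- move=> x y a b c _ _; rewrite perm_cat2l perm_cat2r perm_cons.
  by rewrite -(cat1s a) perm_catC.
- exact: perm_refl.
- by rewrite perm_sym.
- exact: perm_trans p12 p23.
Qed.

(** * A word is Knuth equivalent to the reading word of its tableau *)

Lemma knuth_bump_head x y r : x < y -> path leq y r ->
  knuth_equiv (rcons (y :: r) x) [:: y, x & r].
Proof.
move=> xy; elim: r y xy => [|z r IH] y xy /=; first by move=> _; apply: rst_refl.
case/andP=> yz /(IH _ (leq_trans xy yz)) /(knuth_equiv_catl [:: y]) K.
apply: rst_trans K _; apply/rst_sym/rst_step.
exact: (@knuth_bac [::] r x y z).
Qed.

(** The letter [x] first travels left past the larger entries by BAC moves, until it stands just
    right of the entry it bumps. That entry then travels to the front by ACB moves. *)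
Lemma knuth_row_insertion x r : sorted leq r ->
  knuth_equiv (rcons r x) (bumped x r ++ bumping_row x r).
Proof.
elim: r => [|y r IH] sr; first exact: rst_refl.
rewrite bumped_cons bumping_row_cons; case: ltnP => xy.
  exact: knuth_bump_head.
have /(knuth_equiv_catl [:: y]) K := IH (path_sorted sr).
apply: rst_trans K _; case: bumpedP => [_|z xz zr]; first exact: rst_refl.
(* The head [a] of the new tail is at most [x], since the tail is sorted and contains [x]. This
   gives [y <= a < z], the condition for an ACB move. *)
have := sorted_bumping_row x (path_sorted sr).
have := mem_bumping_row x r.
have := all_bumping_row (leq y) x r.
rewrite (order_path_min leq_trans sr) xy => /andP[_].
case: bumping_row => // a s /= /andP[ya _] xs /(order_path_min leq_trans) as_.
apply: rst_step; apply: (@knuth_acb [::] s) => //.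
apply: leq_ltn_trans xz; move: xs; rewrite inE => /predU1P[->//|].
by move/allP: as_; apply.
Qed.

Lemma reading_word_cons r t : reading_word (r :: t) = reading_word t ++ r.
Proof. by rewrite /reading_word rev_cons flatten_rcons. Qed.

Lemma knuth_tab_insert x t : all (sorted leq) t ->
  knuth_equiv (rcons (reading_word t) x) (reading_word (tab_insert x t)).
Proof.
elim: t x => [|r t IH] x; first by move=> _; apply: rst_refl.
move=> /andP[sr st]; rewrite tab_insert_cons !reading_word_cons rcons_cat.
apply: rst_trans (knuth_equiv_catl _ (knuth_row_insertion x sr)) _.
rewrite catA; apply: knuth_equiv_catr.
case: bumpedP => [_|y _ _]; first by rewrite cats0; apply: rst_refl.
by rewrite cats1; apply: IH.
Qed.

(** * Insertion preserves tableaux *)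

Lemma dominates_nil e r : dominates e r [::].
Proof. by case: r. Qed.

Lemma dominates_bumping_row x r s :
  dominates ltn r s -> dominates ltn (bumping_row x r) s.
Proof.
elim: r s => [|a r IH] [|b s]; rewrite ?dominates_nil //= => /andP[ab rs].
rewrite bumping_row_cons; case: ltnP => xa /=; first by rewrite (ltn_trans xa).
by rewrite ab IH.
Qed.

(** The entry below the place of a bumped letter exceeds that letter, which therefore lands weakly
    to the left of its old column, under a smaller letter. *)
Lemma dominates_bumping x r s : dominates ltn r s ->
  dominates ltn (bumping_row x r) (insert_word_row s (bumped x r)).
Proof.
elim: r s => [|a r IH] s; first by case: s.
rewrite bumped_cons bumping_row_cons; case: (ltnP x a) => xa.
  case: s => [|b s] /=; first by rewrite /bumping_row /= xa dominates_nil.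
  by case/andP=> ab rs; rewrite bumping_row_lt //= xa.
case: s => [|b s] /=.
  case: bumpedP => [_|y xy _] //= _; rewrite dominates_nil andbT.
  exact: leq_ltn_trans xy.
case/andP=> ab rs; move: (IH s rs); case: bumpedP => [_|y xy _] /=.
  by rewrite ab.
case: (ltnP y b) => yb dom.
  by rewrite bumping_row_lt //= (leq_ltn_trans xa xy) dominates_bumping_row.
by rewrite bumping_row_ge //= ab.
Qed.

Lemma head_insert_word t v :
  head [::] (insert_word t v) = insert_word_row (head [::] t) v.
Proof.
case: t v => [|r t] v; last by rewrite insert_word_cons.
by case: v => // x v; rewrite insert_word_behead.
Qed.

Lemma tableau_tab_insert x t : tableau t -> tableau (tab_insert x t).
Proof.
elim: t x => // r t IH x /= /and4P[_ sr dom tt].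
rewrite -/(tab_insert x (r :: t)) tab_insert_cons /= sorted_bumping_row //.
rewrite head_insert_word dominates_bumping //.
have -> : bumping_row x r != [::] by have := mem_bumping_row x r; case: bumping_row.
by case: bumpedP => [_|y _ _] //=; apply: IH.
Qed.

Lemma tableau_insert_word t v : tableau t -> tableau (insert_word t v).
Proof. by elim: v t => //= x v IH t /(tableau_tab_insert x)/IH. Qed.

Lemma tableau_insertion_tableau w : tableau (insertion_tableau w).
Proof. exact: (@tableau_insert_word [::]). Qed.

Lemma tableau_sorted t : tableau t -> all (sorted leq) t.
Proof. by elim: t => //= r t IH /and4P[_ -> _ /IH]. Qed.

Lemma knuth_reading_word w :
  knuth_equiv w (reading_word (insertion_tableau w)).
Proof.
elim/last_ind: w => [|w x IH]; first exact: rst_refl.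
rewrite -cats1; apply: rst_trans (knuth_equiv_catr [:: x] IH) _.
rewrite /insertion_tableau foldl_cat cats1.
exact/knuth_tab_insert/tableau_sorted/tableau_insertion_tableau.
Qed.

(** * Left multiplication by a letter as column insertion *)

Lemma word_insert_ge y q v : all (leq y) v ->
  bumped_word (y :: q) v = bumped_word q v /\
  insert_word_row (y :: q) v = y :: insert_word_row q v.
Proof.
elim: v q => //= x v IH q /andP[yx yv].
by rewrite bumped_ge // bumping_row_ge //; have [-> ->] := IH (bumping_row x q) yv.
Qed.

Lemma word_insert_row_cons x r y q : sorted leq (x :: r) -> x < y ->
  bumped_word (y :: q) (x :: r) = y :: bumped_word q r /\
  insert_word_row (y :: q) (x :: r) = x :: insert_word_row q r.
Proof.
move=> /(order_path_min leq_trans) xr xy.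
rewrite /= bumped_lt // bumping_row_lt //.
by have [-> ->] := word_insert_ge q xr.
Qed.

(** From left to right, each letter of [r] bumps the entry of [s] in its own column; the letters
    beyond the end of [s] are appended. *)
Lemma row_insert_dominated r s : sorted leq r -> dominates ltn r s ->
  bumped_word s r = s /\ insert_word_row s r = r.
Proof.
elim: r s => [|x r IH] [|y s] // sr.
  have [b i] := word_insert_ge [::] (order_path_min leq_trans sr).
  have [IH1 IH2] := IH [::] (path_sorted sr) (dominates_nil _ _).
  by split; [exact: etrans b IH1 | exact: etrans i (congr1 _ IH2)].
case/andP=> xy rs; have [-> ->] := word_insert_row_cons s sr xy.
by have [-> ->] := IH s (path_sorted sr) rs.
Qed.

Inductive letter_added : seq nat -> seq nat -> Prop :=
| AddedHere e r : letter_added r (e :: r)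
| AddedThere y r q of letter_added r q : letter_added (y :: r) (y :: q).

Lemma letter_added_count (p : pred nat) r q :
  letter_added r q -> count p r <= count p q.
Proof. by elim=> {r q} [e r|y r q _ IH] /=; [apply: leq_addl | rewrite leq_add2l]. Qed.

Lemma dominates_refl s : dominates leq s s.
Proof. by elim: s => //= x s ->; rewrite leqnn. Qed.

Lemma dominates_le_lt r s t :
  dominates leq r s -> dominates ltn s t -> dominates ltn r t.
Proof.
elim: t r s => [|c t IH] r s; first by rewrite !dominates_nil.
case: s => [|b s]; first by case: r.
case: r => [//|a r] /= /andP[ab rs] /andP[bc st].
by rewrite (leq_ltn_trans ab bc) (IH r s).
Qed.

(* When the column-insertion path of a letter enters row [R], turning it into
   [q], a row [r] placed above [R] is either entered by the path in turn or left
   unchanged. *)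
Lemma row_insert_letter_added r R q :
    sorted leq r -> sorted leq q -> dominates ltn r R ->
    q = R \/ letter_added R q ->
  [/\ insert_word_row q r = r \/ letter_added r (insert_word_row q r),
      dominates ltn r (bumped_word q r),
      dominates leq (bumped_word q r) R &
      subseq (bumped_word q r) q].
Proof.
move=> sr sq dom [->|addq].
  have [-> ->] := row_insert_dominated sr dom.
  by split; rewrite ?dominates_refl //; left.
(* If the new letter [e] is at most the first letter of the row, it stays in front: the path enters
   the row there, and the row bumps out exactly [s]. *)
have here e s x r' : sorted leq (x :: r') -> e <= x -> dominates ltn (x :: r') s ->
  [/\ insert_word_row (e :: s) (x :: r') = x :: r'
        \/ letter_added (x :: r') (insert_word_row (e :: s) (x :: r')),
      dominates ltn (x :: r') (bumped_word (e :: s) (x :: r')),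
      dominates leq (bumped_word (e :: s) (x :: r')) s &
      subseq (bumped_word (e :: s) (x :: r')) (e :: s)].
  move=> sx ex dom'; have ge : all (leq e) (x :: r').
    rewrite /= ex; apply: sub_all (order_path_min leq_trans sx) => z.
    exact: leq_trans.
  have [-> ->] := word_insert_ge s ge.
  have [-> ->] := row_insert_dominated sx dom'.
  by split; rewrite ?dominates_refl ?subseq_cons //; right; constructor.
elim: addq r sr sq dom => {R q} [e R|y R q _ IH] r sr sq dom.
  elim: R e r sr sq dom => [|y R IH] e [|x r] sr sq dom //.
  - by split=> //; right; constructor.
  - case: (ltnP x e) => [xe|]; last by move=> ex; apply: here.
    have [-> ->] := word_insert_row_cons [::] sr xe.
    have [-> ->] := row_insert_dominated (path_sorted sr) (dominates_nil _ _).
    by split=> /=; rewrite ?xe ?dominates_nil ?eqxx //; left.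
  case: (ltnP x e) => [xe|]; last by move=> ex; apply: here.
  (* Here [x] bumps [e], and [y] takes over the role of the added letter, with [r] placed above
     [R]. *)
  case/andP: dom => xy dom; case/andP: sq => ey sq.
  have [-> ->] := word_insert_row_cons (y :: R) sr xe.
  have [i d1 d2 ss] := IH y r (path_sorted sr) sq dom.
  split; rewrite /= ?xe ?ey ?eqxx //.
  by case: i => [->|i]; [left | right; constructor].
case: r sr dom => // x r sr /andP[xy dom].
have [-> ->] := word_insert_row_cons q sr xy.
have [i d1 d2 ss] := IH r (path_sorted sr) (path_sorted sq) dom.
split; rewrite /= ?(xy : x < y) ?leqnn ?eqxx //.
by case: i => [->|i]; [left | right; constructor].
Qed.

(** Each row is bumped out whole by the row arriving from above and in turn replaces the next
    one. *)
Lemma insert_word_dominated t v : tableau t -> sorted leq v -> v != [::] ->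
  dominates ltn v (head [::] t) -> insert_word t v = v :: t.
Proof.
elim: t v => [|r t IH] v.
  move=> _ sv nv dom; rewrite insert_word_behead ?nv //=.
  by have [-> ->] := row_insert_dominated sv dom.
move=> /= /and4P[nr sr rt tt] sv _ vr.
rewrite insert_word_cons; have [-> ->] := row_insert_dominated sv vr.
by rewrite IH.
Qed.

Definition first_rows_count (p : pred nat) (k : nat) (t : seq (seq nat)) : nat :=
  count p (flatten (take k t)).

Lemma first_rows_count_cons p k r t :
  first_rows_count p k.+1 (r :: t) = count p r + first_rows_count p k t.
Proof. exact: count_cat. Qed.

(* Column insertion of [a], carried out by row-inserting the rows of [t] from
   bottom to top: the insertion path only moves letters upwards. *)
Lemma insert_letter_left a t : tableau t -> exists q Q,
  [/\ insert_word [::] (a :: reading_word t) = q :: Q,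
      q = head [::] t \/ letter_added (head [::] t) q,
      dominates ltn (head [::] t) (head [::] Q) &
      forall p k, first_rows_count p k t <= first_rows_count p k (q :: Q)].
Proof.
elim: t => [|r t IH].
  by exists [:: a], [::]; split=> //; right; constructor.
case/and4P=> nr sr rt /IH [q [Q [E addq dom cnt]]].
have tqQ : tableau (q :: Q) by rewrite -E; apply: tableau_insert_word.
case/and4P: (tqQ) => nq sq _ tQ.
have [addr rb bt bq] := row_insert_letter_added sr sq rt addq.
have perm_qr p : count p (insert_word_row q r) + count p (bumped_word q r)
    = count p r + count p q.
  rewrite addnC -count_cat (permP (perm_insert_word_row q r)).
  by rewrite count_cat addnC.
exists (insert_word_row q r), (insert_word Q (bumped_word q r)); split.
- by rewrite reading_word_cons -cat_cons insert_word_cat E insert_word_cons.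
- by case: addr; [left | right].
- rewrite head_insert_word.
  have := dominates_le_lt bt dom.
  by move/(row_insert_dominated (subseq_sorted leq_trans bq sq)) => [_ ->].
move=> p [|[|k]]; rewrite ?first_rows_count_cons //.
  rewrite /first_rows_count !take0 /= !addn0.
  by case: addr => [->//|/letter_added_count ->].
(* The word bumped out of [q] can stand above [Q], so it becomes a new row on top of it. If it is
   empty, then so is [Q]. *)
have -> : first_rows_count p k.+1 (insert_word Q (bumped_word q r)) =
    count p (bumped_word q r) + first_rows_count p k Q.
  have domQ := dominates_le_lt bt dom.
  case: (altP (bumped_word q r =P [::])) => [b0|nb].
    move: domQ tQ; rewrite b0; case: (Q) => //= -[|//] Q' _ /and4P[].
    by rewrite eqxx.
  have sb := subseq_sorted leq_trans bq sq.
  by rewrite insert_word_dominated ?first_rows_count_cons.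
(* The first two new rows have together the content of [r] and [q], so the claim reduces to the one
   for the rows below [r]. *)
rewrite addnA perm_qr -addnA leq_add2l -first_rows_count_cons; exact: cnt.
Qed.

Lemma first_rows_count_catl p k v w :
  first_rows_count p k (insertion_tableau w)
    <= first_rows_count p k (insertion_tableau (v ++ w)).
Proof.
elim: v => //= a v /leq_trans; apply.
have /(knuth_equiv_catl [:: a]) /insertion_tableau_knuth /= -> :=
  knuth_reading_word (v ++ w).
have [q [Q [E _ _ cnt]]] := insert_letter_left a (tableau_insertion_tableau (v ++ w)).
by rewrite {2}/insertion_tableau -/(insert_word _ _) E; apply: cnt.
Qed.

(** * Decreasing chains and the expulsion of large letters *)

(** The two claims follow a chain through the row. In the first, the preceding chain letter [e] is
    still in the row, so the next one, [d < e], bumps a letter in the interval from [d + 1] to [e].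
    Should another letter bump [e] earlier, [e] itself enters the new chain, and the second claim
    takes over: it waits for [d] to be inserted. The bounds on [B] make the pieces strictly
    decreasing. *)
Lemma bumped_word_chain r v : sorted leq r ->
  (forall e D, e \in r -> path gtn e D -> subseq D v ->
    exists B, [/\ size B = size D, sorted gtn B, subseq B (bumped_word r v)
                & all (leq^~ e) B]) /\
  (forall d D, path gtn d D -> subseq (d :: D) v ->
    exists B, [/\ size B = size D, sorted gtn B, subseq B (bumped_word r v)
                & all (leq^~ d) B]).
Proof.
have cons_chain y B : all (ltn^~ y) B -> sorted gtn B -> sorted gtn (y :: B).
  by case: B => //= b B /andP[-> _].
elim: v r => [|x v IH] r sr.
  by split=> [e [|d D] // _ _ _|//]; exists [::].
have [IHs IHw] := IH _ (sorted_bumping_row x sr).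
split=> [e [|d D] er|d D] dD.
- by move=> _; exists [::]; split=> //; apply: sub0seq.
- move: dD; rewrite [path _ _ _]/= => /andP[de dD].
  have es z : z <= d -> z <= e by move=> zd; apply: leq_trans zd (ltnW de).
  rewrite [subseq _ _]/= [d == x]eq_sym; case: eqP => [xd|xd] sub.
    rewrite -{}xd in de dD sub es *.
    have [y Ey ye] := bumped_leq sr er de.
    have xy : x < y by move: Ey; case: bumpedP => // z xz _ [<-].
    have [B [sB gB BB leB]] := IHs x D (mem_bumping_row x r) dD sub.
    exists (y :: B); rewrite /= sB Ey /= eqxx ye; split=> //.
      by apply: cons_chain => //; apply: sub_all leB => z /leq_ltn_trans; apply.
    by apply: sub_all leB.
  have := perm_mem (perm_bumping_row x r) e.
  rewrite mem_rcons inE er orbT mem_cat => /orP[eb|er'].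
    have [B [sB gB BB leB]] := IHw d D dD sub.
    have Eb : bumped x r = [:: e].
      by move: eb; case: bumpedP => // z _ _; rewrite inE => /eqP->.
    exists (e :: B); rewrite /= sB Eb /= eqxx leqnn; split=> //.
      by apply: cons_chain => //; apply: sub_all leB => z /leq_ltn_trans; apply.
    exact: sub_all leB.
  have [|B [sB gB BB leB]] := IHs e (d :: D) er' _ sub; first by rewrite /= de.
  by exists B; split=> //; apply: subseq_trans BB (suffix_subseq _ _).
rewrite [subseq _ _]/= eq_sym; case: eqP => [xd|_] sub.
  rewrite -{}xd in dD *.
  have [B [sB gB BB leB]] := IHs x D (mem_bumping_row x r) dD sub.
  by exists B; split=> //; apply: subseq_trans BB (suffix_subseq _ _).
have [B [sB gB BB leB]] := IHw d D dD sub.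
by exists B; split=> //; apply: subseq_trans BB (suffix_subseq _ _).
Qed.

Definition has_chain (l : nat) (v : seq nat) : Prop :=
  exists D, [/\ size D = l, sorted gtn D & subseq D v].

Lemma has_chain_bumped l r v :
  sorted leq r -> has_chain l.+1 v -> has_chain l (bumped_word r v).
Proof.
move=> sr [[|d D] [//] [sD] dD sub].
have [B [sB gB BB _]] := (bumped_word_chain v sr).2 d D dD sub.
by exists B; rewrite sB sD.
Qed.

Lemma all_insert_word_row p r v : all p r -> all p v ->
  all p (bumped_word r v) && all p (insert_word_row r v).
Proof.
move=> hr hv.
by rewrite -all_cat (perm_all _ (perm_insert_word_row r v)) all_cat hr.
Qed.

(* A letter at most [m] inserted into a row with an entry exceeding [m] replaces
   some entry by a smaller one. *)
Lemma small_insert_sumn m r v : all (leq^~ m) v ->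
  all (leq^~ m) (insert_word_row r v) \/
  sumn (insert_word_row r v) + size v <= sumn r.
Proof.
elim: v r => [|x v IH] r /=; first by right; rewrite addn0.
case/andP=> xm vm; have [?|le] := IH (bumping_row x r) vm; first by left.
have [rs|] := boolP (all (leq^~ m) (bumping_row x r)).
  by left; case/andP: (all_insert_word_row rs vm).
move=> nsm; right; have := perm_sumn (perm_bumping_row x r).
have := all_bumping_row (leq^~ m) x r.
rewrite (negbTE nsm) andbF xm andbT => /esym/negbT nr.
rewrite sumn_cat sumn_rcons; case: bumpedP => [h|y xy _] /=.
  by case/negP: nr; apply: sub_all h => z /leq_trans; apply.
by lia.
Qed.

(** The chunks may vary with the index: equal copies of one word inserted into a row need not bump
    out equal words. *)
Definition chunks (c : nat -> seq nat) (n : nat) : seq nat := flatten (mkseq c n).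

Lemma chunksS c n : chunks c n.+1 = chunks c n ++ c n.
Proof. by rewrite /chunks mkseqS flatten_rcons. Qed.

(** The first [k] chunks are set apart to clear the row of large letters; what the later ones bump
    out is again cut into chunks, as an induction on rows requires. *)
Lemma bumped_chunks r c k n :
  bumped_word r (chunks c (k + n)) = bumped_word r (chunks c k) ++
    chunks (fun j => bumped_word (insert_word_row r (chunks c (k + j))) (c (k + j))) n.
Proof.
elim: n => [|n IH]; first by rewrite addn0 cats0.
by rewrite addnS !chunksS bumped_word_cat IH catA.
Qed.

(* Row by row: once the row has lost its large entries, the chunks bumped out of
   it are again small, and their decreasing chains are shorter by one. *)
Lemma expel_large m l t c : tableau t -> (forall j, all (leq^~ m) (c j)) ->
    (forall j, has_chain l (c j)) ->
  exists n, all (all (leq^~ m)) (take l (insert_word t (chunks c n))).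
Proof.
elim: l t c => [|l IH] t c tt cs cl; first by exists 0; rewrite take0.
(* Each chunk contains a chain of length [l.+1], so it is nonempty. After [N] chunks the sum of the
   row would have dropped by more than [sumn r] if a large letter were left. *)
set r := head [::] t; set N := (sumn r).+1.
have sr : sorted leq r by rewrite /r; case: (t) tt => //= a s /and4P[].
have chunk_small n : all (leq^~ m) (chunks c n).
  by elim: n => // n IHn; rewrite chunksS all_cat IHn cs.
have chunk_size n : n <= size (chunks c n).
  elim: n => // n IHn; rewrite chunksS size_cat -addn1 leq_add //.
  by have [D [sD _ /size_subseq]] := cl n; rewrite sD; apply: leq_trans.
have rs j : all (leq^~ m) (insert_word_row r (chunks c (N + j))).
  have [//|] := small_insert_sumn r (chunk_small (N + j)).
  by have := chunk_size (N + j); rewrite {1}/N; lia.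
set c' := fun j => bumped_word (insert_word_row r (chunks c (N + j))) (c (N + j)).
have [|||n hn] := IH (insert_word (behead t) (bumped_word r (chunks c N))) c'.
- by apply: tableau_insert_word; case: (t) tt => //= a s /and4P[].
- by move=> j; case/andP: (all_insert_word_row (rs j) (cs (N + j))).
- move=> j; apply: has_chain_bumped (cl _).
  exact: sorted_insert_word_row.
exists (N + n); rewrite insert_word_behead; last first.
  (* The inserted word is nonempty because [N] is positive; this covers an empty [t]. *)
  by rewrite -[chunks _ _ == _]size_eq0 -lt0n (leq_trans _ (chunk_size _)) ?orbT.
by rewrite /= rs -/r bumped_chunks insert_word_cat.
Qed.

(** The chain is the first column, read from bottom to top. *)
Lemma has_chain_reading_word t : tableau t -> has_chain (size t) (reading_word t).
Proof.
move=> tt; exists (rev (map (head 0) t)); split.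
- by rewrite size_rev size_map.
- rewrite rev_sorted; elim: t tt => //= r [|s t] IH //= /and4P[].
  by case: r => // a r _ _; case: s IH => // b s IH /= /andP[-> _] /IH.
rewrite -map_rev /reading_word.
have : all (fun r => r != [::]) (rev t).
  by rewrite all_rev; elim: t tt => //= r t IH /and4P[-> _ _ /IH].
elim: (rev t) => //= -[|a r] s IH //= /IH; rewrite eqxx => h.
exact: subseq_trans h (suffix_subseq _ _).
Qed.

(** * Powers of [v] and the conclusion *)

Lemma knuth_chunks_commute v w n : knuth_equiv (v ++ w) (w ++ v) ->
  knuth_equiv (chunks (fun=> v) n ++ w) (w ++ chunks (fun=> v) n).
Proof.
move=> K; elim: n => [|n IH]; first by rewrite cats0; apply: rst_refl.
rewrite chunksS -catA; apply: rst_trans (knuth_equiv_catl _ K) _.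
by rewrite !catA; apply: knuth_equiv_catr.
Qed.

Theorem theorem4p3 (u w : seq nat) (hu : word u) (hw : word w)
    (u_nonempty : u <> [::])
    (uw_wu : knuth_equiv (u ++ w) (w ++ u)) :
  forall i : nat, i < size (insertion_tableau u) ->
  forall x : nat, x \in nth [::] (insertion_tableau w) i ->
  x <= max_letter u.
Proof.
move=> i il x xi; set m := max_letter u.
set l := size (insertion_tableau u); set v := reading_word (insertion_tableau u).
have uv : knuth_equiv u v := knuth_reading_word u.
have vw_wv : knuth_equiv (v ++ w) (w ++ v).
  apply: rst_trans (knuth_equiv_catr w (rst_sym _ _ _ _ uv)) _.
  exact: rst_trans uw_wu (knuth_equiv_catl w uv).
have vm : all (leq^~ m) v.
  rewrite -(perm_all _ (knuth_equiv_perm uv)); apply/allP=> a au.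
  exact: (@leq_bigmax_seq _ u xpredT id a au).
have [n hn] := expel_large (tableau_insertion_tableau w) (fun=> vm)
  (fun=> has_chain_reading_word (tableau_insertion_tableau u)).
have := first_rows_count_catl (ltn m) l (chunks (fun=> v) n) w.
rewrite (insertion_tableau_knuth (knuth_chunks_commute n vw_wv)).
rewrite /insertion_tableau foldl_cat -/(insertion_tableau w) -/(insert_word _ _).
set T := insert_word _ _ in hn *.
have -> : first_rows_count (ltn m) l T = 0.
  apply/eqP; rewrite -leqn0 leqNgt -has_count.
  apply/hasPn => a /flattenP[r rT ar].
  by have /allP/(_ _ ar) := allP hn _ rT; rewrite -leqNgt.
rewrite leqn0 -leqn0 leqNgt -has_count => /hasPn h.
rewrite leqNgt; apply: h; apply/flattenP.
exists (nth [::] (insertion_tableau w) i) => //.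
rewrite -(nth_take _ il); apply: mem_nth; rewrite size_take_min leq_min il.
(* Row [i] of [P(w)] exists: beyond the last row [nth] returns the empty row, which cannot contain
   [x]. *)
by rewrite ltnNge; apply/negP => /(nth_default [::]) E; rewrite E in xi.
Qed.
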